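(* Let $(A,\Delta)$ be a multiplier Hopf algebra. Then $A$ has local units: for any finite subset $a_1,\dots,a_n$ of $A$ there is an element $e\in A$ such that $a_ie=a_i$ and $ea_i=a_i$ for all $i=1,\dots,n$.
   Context: Algebras are associative algebras over a field, not necessarily with identity. An algebra $A$ is non-degenerate if for every $a\in A$: ($ab=0$ for all $b\in A$) implies $a=0$, and ($ba=0$ for all $b\in A$) implies $a=0$. For a non-degenerate algebra $A$, the multiplier algebra $M(A)$ is the set of pairs $x=(\rho,\lambda)$ of maps $A\to A$ satisfying $\rho(a)b=a\lambda(b)$ for all $a,b\in A$; one writes $xa:=\lambda(a)$ and $ax:=\rho(a)$. It is a unital algebra with pointwise linear structure and product determined by $(xy)a=x(ya)$, $a(xy)=(ax)y$, and it contains $A$ as a two-sided ideal via $a\mapsto(b\mapsto ba,\ b\mapsto ab)$. If $A$ is non-degenerate, so is $A\otimes A$, and $M(A)\otimes M(A)\subseteq M(A\otimes A)$; let $1$ denote the unit of $M(A)$ and $\iota$ the identity map. A multiplier Hopf algebra (in the sense of Van Daele) is a pair $(A,\Delta)$ of a non-degenerate algebra $A$ and a homomorphism $\Delta:A\to M(A\otimes A)$ such that: (1) $\Delta(a)(1\otimes b)$ and $(a\otimes1)\Delta(b)$ belong to $A\otimes A$ for all $a,b\in A$; (2) $\Delta$ is coassociative: $(a\otimes1\otimes1)(\Delta\otimes\iota)(\Delta(b)(1\otimes c))=(\iota\otimes\Delta)((a\otimes1)\Delta(b))(1\otimes1\otimes c)$ for all $a,b,c\in A$; (3) the linear maps $A\otimes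 A\to A\otimes A$ given by $a\otimes b\mapsto\Delta(a)(1\otimes b)$ and $a\otimes b\mapsto(a\otimes1)\Delta(b)$ are bijective. *)

(* Defs.v *)
From HB Require Import structures.
From mathcomp Require Import all_boot all_order all_algebra.
From mathcomp Require Import boolp classical_sets.
From mathcomp.multinomials Require Import freeg.

Set Implicit Arguments.
Unset Strict Implicit.
Unset Printing Implicit Defensive.

Import GRing.Theory.
Local Open Scope ring_scope.
Local Open Scope quotient_scope.

Section TensorProduct.
Import Quotient.
Variables (K : fieldType) (U V : lmodType K).
Local Notation F := {freeg (U * V)%type / K}.
Local Notation gen u v := (<< (u, v) >> : F).

(* The subspace of the free vector space on U * V generated by the bilinearity
   relations; tensor below is the quotient by it. *)
Inductive tensor_rel : F -> Prop :=
| tensor_rel0 : tensor_rel 0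
| tensor_relP (k : K) x y :
    tensor_rel x -> tensor_rel y -> tensor_rel (k *: x + y)
| tensor_rel_linl (k : K) u u' v :
    tensor_rel (gen (k *: u + u') v - (k *: gen u v + gen u' v))
| tensor_rel_linr (k : K) u v v' :
    tensor_rel (gen u (k *: v + v') - (k *: gen u v + gen u v')).

Definition tensor_null : {pred F} := fun x => `[< tensor_rel x >].

Fact tensor_null_zmod_closed : zmod_closed tensor_null.
Proof.
split=> [|x y /asboolP rx /asboolP ry]; apply/asboolP.
  exact: tensor_rel0.
by rewrite addrC -scaleN1r; apply: tensor_relP.
Qed.

HB.instance Definition _ :=
  GRing.isZmodClosed.Build F tensor_null tensor_null_zmod_closed.

Definition tensor : Type := {quot tensor_null}.
HB.instance Definition _ := GRing.Zmodule.on tensor.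

Definition tensor_pi (x : F) : tensor := \pi_({quot tensor_null}) x.

Lemma tensor_piE x y : tensor_pi x = tensor_pi y <-> tensor_rel (x - y).
Proof.
rewrite -[tensor_rel _]asboolE.
have -> : `[< tensor_rel (x - y) >] = (x - y \in tensor_null) by [].
by rewrite idealrBE; split=> [e|/eqP //]; apply/eqP; exact: e.
Qed.

Lemma tensor_piD x y : tensor_pi (x + y) = tensor_pi x + tensor_pi y.
Proof. exact: pi_add. Qed.

Lemma tensor_piK x : tensor_pi (repr x) = x.
Proof. exact: reprK. Qed.

Definition tensor_scale (k : K) (x : tensor) : tensor :=
  tensor_pi (k *: repr x).

Lemma tensor_piZ k x : tensor_pi (k *: x) = tensor_scale k (tensor_pi x).
Proof.
apply/tensor_piE; rewrite -scalerBr -[_ *: _]addr0.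
apply: tensor_relP; last exact: tensor_rel0.
by apply/tensor_piE; rewrite tensor_piK.
Qed.

Fact tensor_scaleA a b x :
  tensor_scale a (tensor_scale b x) = tensor_scale (a * b) x.
Proof. by rewrite -(tensor_piK x) -!tensor_piZ scalerA. Qed.
Fact tensor_scale1 : left_id 1 tensor_scale.
Proof. by move=> x; rewrite -(tensor_piK x) -!tensor_piZ scale1r. Qed.
Fact tensor_scaleDr : right_distributive tensor_scale +%R.
Proof.
move=> a x y; rewrite -(tensor_piK x) -(tensor_piK y).
by rewrite -tensor_piD -!tensor_piZ -tensor_piD scalerDr.
Qed.
Fact tensor_scaleDl x : {morph tensor_scale^~ x : a b / a + b}.
Proof.
move=> a b; rewrite -(tensor_piK x).
by rewrite -!tensor_piZ -tensor_piD scalerDl.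
Qed.

HB.instance Definition _ := GRing.Zmodule_isLmodule.Build K tensor
  tensor_scaleA tensor_scale1 tensor_scaleDr tensor_scaleDl.

Fact tensor_pi_linear : linear tensor_pi.
Proof. by move=> a x y; rewrite tensor_piD tensor_piZ. Qed.
HB.instance Definition _ :=
  GRing.isLinear.Build K F tensor _ tensor_pi tensor_pi_linear.

Definition tens (u : U) (v : V) : tensor := tensor_pi (gen u v).

Fact tens_bilinear : bilinear_for *:%R *:%R tens.
Proof.
split=> [v a u u'|u a v v']; rewrite /= /tens -linearP; apply/tensor_piE.
- exact: tensor_rel_linl.
- exact: tensor_rel_linr.
Qed.
HB.instance Definition _ :=
  bilinear_isBilinear.Build K U V tensor _ _ tens tens_bilinear.

Lemma free_genZ k (p : U * V) : << k *g p >> = k *: << p >> :> F.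
Proof. by apply/eqP/freeg_eqP => q; rewrite coeffZ !coeffU mul1r. Qed.

Lemma tensor_ind (P : tensor -> Prop) :
    (forall u v, P (tens u v)) -> (forall x y, P x -> P y -> P (x + y)) ->
  forall x, P x.
Proof.
move=> Pt PD x; rewrite -[x]tensor_piK; move: (repr x) => r.
rewrite -(freeg_sumE r) linear_sum /=; apply: (big_ind P) => // [|[u v] _].
  by rewrite -[0](linear0l tens 0).
by rewrite free_genZ linearZ /= -/(tens u v) -linearZl_LR.
Qed.

Section Lift.
Variable W : lmodType K.

Definition free_lift (f : U -> V -> W) : F -> W :=
  fglift (fun p => f p.1 p.2).

Fact free_lift_linear f : linear (free_lift f).
Proof.
have B := lift_is_additive (fun p => f p.1 p.2); rewrite -/(free_lift f) in B.
have B0 : free_lift f 0 = 0 by have := B 0 0; rewrite !subrr.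
have D x y : free_lift f (x + y) = free_lift f x + free_lift f y.
  have N : free_lift f (- y) = - free_lift f y.
    by have := B 0 y; rewrite B0 !sub0r.
  by have := B x (- y); rewrite N !opprK.
move=> a x y; rewrite D; congr (_ + _); rewrite -(freeg_sumE x).
rewrite scaler_sumr !(big_morph _ D B0) scaler_sumr; apply: eq_bigr => p _.
by rewrite free_genZ scalerA -!free_genZ /free_lift !liftU scalerA.
Qed.
HB.instance Definition _ f :=
  GRing.isLinear.Build K F W _ (free_lift f) (free_lift_linear f).

Lemma free_lift_gen f u v : free_lift f (gen u v) = f u v.
Proof. by rewrite /free_lift liftU scale1r. Qed.

Lemma free_lift_rel (f : {bilinear U -> V -> W}) x :
  tensor_rel x -> free_lift f x = 0.
Proof.
elim=> {x} [|k x y _ Lx _ Ly|k u u' v|k u v v'].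
- exact: linear0.
- by rewrite linearP /= Lx Ly scaler0 addr0.
- by rewrite linearB linearP /= !free_lift_gen linearPl subrr.
- by rewrite linearB linearP /= !free_lift_gen linearPr subrr.
Qed.

Definition tlift (f : {bilinear U -> V -> W}) (x : tensor) : W :=
  free_lift f (repr x).

Lemma tlift_pi f x : tlift f (tensor_pi x) = free_lift f x.
Proof.
apply/eqP; rewrite -subr_eq0 -linearB.
by apply/eqP/free_lift_rel/tensor_piE; rewrite tensor_piK.
Qed.

Fact tlift_linear f : linear (tlift f).
Proof.
move=> a x y; rewrite -[x]tensor_piK -[y]tensor_piK -linearP.
by rewrite !tlift_pi free_lift_linear.
Qed.
HB.instance Definition _ f :=
  GRing.isLinear.Build K tensor W _ (tlift f) (tlift_linear f).

Lemma tliftE f u v : tlift f (tens u v) = f u v.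
Proof. by rewrite tlift_pi free_lift_gen. Qed.

End Lift.
End TensorProduct.

Arguments tensor_rel {K U V}.
Notation "u ⊗ v" := (tens u v) (at level 40, left associativity) : ring_scope.

Lemma eq_tensor_linear (K : fieldType) (U V W : lmodType K)
    (f g : {linear tensor U V -> W}) :
  (forall u v, f (u ⊗ v) = g (u ⊗ v)) -> f =1 g.
Proof.
by move=> fg; apply: tensor_ind => // x y fx fy; rewrite !linearD fx fy.
Qed.

Section TensorMap.
Variables (K : fieldType) (U U' V V' : lmodType K).
Variables (f : {linear U -> U'}) (g : {linear V -> V'}).

Definition tmap_fun (u : U) (v : V) : tensor U' V' := f u ⊗ g v.
Fact tmap_fun_bilinear : bilinear_for *:%R *:%R tmap_fun.
Proof.
by split=> [v a x y|u a x y]; rewrite /tmap_fun linearP ?linearPl ?linearPr.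
Qed.
HB.instance Definition _ :=
  bilinear_isBilinear.Build K U V (tensor U' V') _ _ tmap_fun tmap_fun_bilinear.

Definition tmap : tensor U V -> tensor U' V' := tlift tmap_fun.
HB.instance Definition _ := GRing.Linear.on tmap.

Lemma tmapE u v : tmap (u ⊗ v) = f u ⊗ g v.
Proof. exact: tliftE. Qed.
End TensorMap.

(* The product of a non-unital algebra is the one of its semigroup structure. *)
Notation "a ** b" := (@monoid.mul _ a b)
  (at level 40, left associativity) : ring_scope.

HB.mixin Record Semigroup_isAlgebra (K : fieldType) A
    of GRing.Lmodule K A & Semigroup A := {
  mulg_bilinear : bilinear_for *:%R *:%R (@monoid.mul A)
}.

(* Associative algebras, not necessarily unital, commutative or nonzero. *)
#[short(type="nuAlgType")]
HB.structure Definition NonUnitalAlgebra (K : fieldType) :=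
  {A of GRing.Lmodule K A & Semigroup A & Semigroup_isAlgebra K A}.

HB.mixin Record NonUnitalAlgebra_isNonDegenerate (K : fieldType) A
    of NonUnitalAlgebra K A := {
  nondegl : forall a : A, (forall b : A, a ** b = 0) -> a = 0;
  nondegr : forall a : A, (forall b : A, b ** a = 0) -> a = 0
}.

#[short(type="ndAlgType")]
HB.structure Definition NonDegenerateAlgebra (K : fieldType) :=
  {A of NonUnitalAlgebra K A & NonUnitalAlgebra_isNonDegenerate K A}.

HB.instance Definition _ (K : fieldType) (A : nuAlgType K) :=
  bilinear_isBilinear.Build K A A A _ _ (@monoid.mul A) mulg_bilinear.

Section MulTheory.
Variables (K : fieldType) (A : nuAlgType K).

Definition lmulg (a b : A) : A := a ** b.
Definition rmulg (a b : A) : A := b ** a.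

Fact lmulg_linear a : linear (lmulg a).
Proof. by move=> k x y; rewrite /lmulg linearPr. Qed.
Fact rmulg_linear a : linear (rmulg a).
Proof. by move=> k x y; rewrite /rmulg linearPl. Qed.
HB.instance Definition _ a := GRing.isLinear.Build K A A _ (lmulg a) (lmulg_linear a).
HB.instance Definition _ a := GRing.isLinear.Build K A A _ (rmulg a) (rmulg_linear a).

Lemma mulgDl (a b c : A) : (a + b) ** c = a ** c + b ** c.
Proof. exact: linearDl. Qed.
Lemma mulgDr (a b c : A) : a ** (b + c) = a ** b + a ** c.
Proof. exact: linearDr. Qed.
Lemma scalegAl k (a b : A) : (k *: a) ** b = k *: (a ** b).
Proof. exact: linearZl_LR. Qed.
Lemma scalegAr k (a b : A) : a ** (k *: b) = k *: (a ** b).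
Proof. exact: linearZr_LR. Qed.
End MulTheory.

Section TensorAlgebra.
Variables (K : fieldType) (A B : nuAlgType K).

Definition tmul_fun (s : tensor A B) (a : A) (b : B) : tensor A B :=
  tmap (lmulg a) (lmulg b) s.

Fact tmul_fun_bilinear s : bilinear_for *:%R *:%R (tmul_fun s).
Proof.
split=> [b k a a'|a k b b'] /=; rewrite /tmul_fun.
- elim/tensor_ind: s => [u v|x y ex ey].
    by rewrite !tmapE /= /lmulg mulgDl scalegAl linearPl.
  by rewrite !linearD /= ex ey addrACA.
- elim/tensor_ind: s => [u v|x y ex ey].
    by rewrite !tmapE /= /lmulg mulgDl scalegAl linearPr.
  by rewrite !linearD /= ex ey addrACA.
Qed.
HB.instance Definition _ s :=
  bilinear_isBilinear.Build K A B (tensor A B) _ _ (tmul_fun s)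
    (tmul_fun_bilinear s).

Definition tmul (t s : tensor A B) : tensor A B := tlift (tmul_fun s) t.

HB.instance Definition _ := hasMul.Build (tensor A B) tmul.

Lemma tmulE a b a' b' :
  (a ⊗ b) ** (a' ⊗ b') = (a ** a') ⊗ (b ** b').
Proof. by rewrite [LHS]tliftE /= /tmul_fun tmapE. Qed.

Fact tmul_bilinear : bilinear_for *:%R *:%R (@monoid.mul (tensor A B)).
Proof.
split=> [s k t t'|t k s s']; first exact: linearP.
have D (x y z : tensor A B) : (x + y) ** z = x ** z + y ** z.
  exact: (linearD (tlift (tmul_fun z))).
elim/tensor_ind: t => [u v|x y ex ey]; last by rewrite !D ex ey /= scalerDr addrACA.
have E (x : tensor A B) : (u ⊗ v) ** x = tmul_fun x u v by exact: tliftE.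
by rewrite !E /tmul_fun linearP.
Qed.

Fact tmulA : associative (@monoid.mul (tensor A B)).
Proof.
move=> x y z.
have D (a b c : tensor A B) : (a + b) ** c = a ** c + b ** c.
  by have /= := tmul_bilinear.1 c 1 a b; rewrite !scale1r.
have D' (a b c : tensor A B) : a ** (b + c) = a ** b + a ** c.
  by have /= := tmul_bilinear.2 a 1 b c; rewrite !scale1r.
elim/tensor_ind: x => [a b|? ? ex ey]; last by rewrite !D ex ey.
elim/tensor_ind: y => [a' b'|? ? ex ey]; last by rewrite !(D, D') ex ey.
elim/tensor_ind: z => [a'' b''|? ? ex ey]; last by rewrite !D' ex ey.
by rewrite !tmulE !mulgA.
Qed.

HB.instance Definition _ := Magma_isSemigroup.Build (tensor A B) tmulA.
HB.instance Definition _ :=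
  Semigroup_isAlgebra.Build K (tensor A B) tmul_bilinear.
End TensorAlgebra.

Section Functionals.
Variables (K : fieldType) (V : lmodType K).
Local Open Scope classical_set_scope.

Let closed (S : set V) := forall (k : K) x y, S x -> S y -> S (k *: x + y).

Lemma max_subspace (v : V) : v != 0 ->
  exists M : set V, [/\ closed M, M 0, ~ M v &
    forall w, exists k : K, M (w - k *: v)].
Proof.
move=> v0; pose P S := closed S /\ ~ S v.
have [|M [[Mc Mv] Mmax]] := @Zorn_bigcup V P.
  move=> F FP Ft; split=> [k x y [X FX Xx] [Y FY Yy]|[X FX Xv]].
    have [XY|YX] := Ft X Y FX FY.
      by exists Y => //; apply: (FP Y FY).1 => //; apply: XY.
    by exists X => //; apply: (FP X FX).1 => //; apply: YX.
  exact: (FP X FX).2.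
have M0 : M 0.
  apply: contrapT => nM0; apply: (Mmax [set 0]).
    split=> [x Mx|/(_ 0 erefl)//].
    by exfalso; apply: nM0; rewrite -(addNr x) -scaleN1r; apply: Mc.
  split=> [k x y -> ->|/eqP]; first by rewrite scaler0 addr0.
  by rewrite (negPf v0).
have MZ k x : M x -> M (k *: x) by move=> Mx; rewrite -[_ *: _]addr0; apply: Mc.
exists M; split=> // w.
have [Mw|nMw] := pselect (M w); first by exists 0; rewrite scale0r subr0.
pose N := [set x | exists k, M (x - k *: w)].
have Nv : N v.
  apply: contrapT => nNv; apply: (Mmax N); last first.
    split=> // k x y [a Ma] [b Mb]; exists (k * a + b).
    rewrite scalerDl opprD addrACA -scalerA -scalerBr; exact: Mc.
  split=> [x Mx|NM]; first by exists 0; rewrite scale0r subr0.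
  by apply/nMw/NM; exists 1; rewrite scale1r subrr.
case: Nv => k Mk; have k0 : k != 0.
  by apply/eqP => k0; apply: Mv; rewrite k0 scale0r subr0 in Mk.
exists k^-1; have := MZ (- k^-1) _ Mk.
by rewrite scalerBr scalerA mulNr mulVf // !scaleNr scale1r opprK addrC.
Qed.

Lemma separating_functional (v : V) : v != 0 ->
  exists f : {linear V -> K^o}, f v = 1.
Proof.
move=> v0; have [M [Mc M0 Mv Mex]] := max_subspace v0.
have MZ k x : M x -> M (k *: x) by move=> Mx; rewrite -[_ *: _]addr0; apply: Mc.
have Muniq w k l : M (w - k *: v) -> M (w - l *: v) -> k = l.
  move=> Mk Ml; apply/eqP; rewrite -subr_eq0; apply/negPn/negP => kl.
  apply: Mv; have := MZ (k - l)^-1 _ (Mc (-1) _ _ Mk Ml).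
  rewrite scaleN1r opprB addrA subrK -scalerBl scalerA mulVf ?scale1r //.
pose f w : K^o := sval (cid (Mex w)).
have fP w : M (w - f w *: v) by rewrite /f; case: cid.
have fL : linear f.
  move=> k x y; apply: (Muniq (k *: x + y)); first exact: fP.
  rewrite scalerDl opprD addrACA -scalerA -scalerBr.
  by apply: Mc; exact: fP.
pose fl := GRing.isLinear.Build K V K^o _ f fL.
pose F : {linear V -> K^o} := HB.pack f fl.
exists F; apply: (Muniq v); first exact: fP.
by rewrite scale1r subrr.
Qed.
End Functionals.

Section Slices.
Variables (K : fieldType) (U V : lmodType K).

Definition slice_fun (f : {linear U -> K^o}) (u : U) (v : V) : V := f u *: v.
Fact slice_fun_bilinear f : bilinear_for *:%R *:%R (slice_fun f).
Proof.
split=> [v k x y|u k x y] /=; rewrite /slice_fun.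
  by rewrite linearP /= scalerDl scalerA.
by rewrite scalerDr !scalerA mulrC.
Qed.
HB.instance Definition _ f :=
  bilinear_isBilinear.Build K U V V _ _ (slice_fun f) (slice_fun_bilinear f).

Definition slice f : tensor U V -> V := tlift (slice_fun f).
HB.instance Definition _ f := GRing.Linear.on (slice f).

Lemma sliceE f u v : slice f (u ⊗ v) = f u *: v.
Proof. exact: tliftE. Qed.

Lemma tensor_seq (x : tensor U V) :
  exists s : seq (U * V), x = \sum_(p <- s) p.1 ⊗ p.2.
Proof.
elim/tensor_ind: x => [u v|x y [s ->] [t ->]].
  by exists [:: (u, v)]; rewrite big_seq1.
by exists (s ++ t); rewrite big_cat.
Qed.

Lemma slice_eq0 (x : tensor U V) : (forall f, slice f x = 0) -> x = 0.
Proof.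
have [s ->] := tensor_seq x; move: {2}(size s) (leqnn (size s)) => n.
elim: n s => [[]// _ _|n IHn [_ _|[u v] s /= sn]]; rewrite ?big_nil //.
move=> s0; have [u0|/separating_functional[f fu]] := eqVneq u 0.
  rewrite big_cons /= u0 linear0l add0r; apply: IHn => // f.
  by have := s0 f; rewrite big_cons /= u0 linear0l add0r.
have vE : v = \sum_(p <- s) - slice f (p.1 ⊗ p.2).
  have := s0 f; rewrite big_cons linearD /= sliceE fu scale1r => /eqP.
  by rewrite addr_eq0 linear_sum /= -sumrN => /eqP.
pose s' := [seq (p.1 - f p.1 *: u, p.2) | p <- s].
have sE : \sum_(p <- (u, v) :: s) p.1 ⊗ p.2 = \sum_(p <- s') p.1 ⊗ p.2.
  rewrite big_cons big_map /= vE linear_sumr -big_split /=.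
  apply: eq_bigr => p _; rewrite sliceE linearNr linearZr_LR.
  by rewrite linearBl /= linearZl_LR addrC.
by rewrite sE; apply: IHn => [|g]; rewrite ?size_map // -sE.
Qed.
End Slices.

Section Swap.
Variables (K : fieldType) (U V : lmodType K).

Definition swap_fun (u : U) (v : V) : tensor V U := v ⊗ u.
Fact swap_fun_bilinear : bilinear_for *:%R *:%R swap_fun.
Proof. by split=> [v k x y|u k x y]; rewrite /swap_fun ?linearPr ?linearPl. Qed.
HB.instance Definition _ :=
  bilinear_isBilinear.Build K U V (tensor V U) _ _ swap_fun swap_fun_bilinear.

Definition swap : tensor U V -> tensor V U := tlift swap_fun.
HB.instance Definition _ := GRing.Linear.on swap.

Lemma swapE u v : swap (u ⊗ v) = v ⊗ u.
Proof. exact: tliftE. Qed.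
End Swap.

Lemma swapK (K : fieldType) (U V : lmodType K) :
  cancel (@swap K U V) (@swap K V U).
Proof.
by apply: tensor_ind => [u v|x y ex ey]; rewrite ?swapE // !linearD /= ex ey.
Qed.

Section TensorNonDegenerate.
Variables (K : fieldType) (A B : ndAlgType K).

Fact tensor_nondegl (x : tensor A B) : (forall y, x ** y = 0) -> x = 0.
Proof.
move=> x0; have xc0 c : tmap (rmulg c) idfun x = 0.
  apply: slice_eq0 => f; apply: nondegl => d.
  transitivity (slice f (x ** (c ⊗ d))); last by rewrite x0 linear0.
  elim/tensor_ind: x {x0} => [a b|x y ex ey].
    by rewrite tmulE tmapE !sliceE scalegAl.
  by rewrite mulgDl !linearD /= mulgDl ex ey.
rewrite -[x]swapK; suff -> : swap x = 0 by rewrite linear0.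
apply: slice_eq0 => f; apply: nondegl => c.
transitivity (slice f (swap (tmap (rmulg c) idfun x))).
  elim/tensor_ind: x {x0 xc0} => [a b|x y ex ey].
    by rewrite tmapE !swapE !sliceE scalegAl.
  by rewrite !linearD /= mulgDl ex ey.
by rewrite xc0 !linear0.
Qed.

Fact tensor_nondegr (x : tensor A B) : (forall y, y ** x = 0) -> x = 0.
Proof.
move=> x0; have xc0 c : tmap (lmulg c) idfun x = 0.
  apply: slice_eq0 => f; apply: nondegr => d.
  transitivity (slice f ((c ⊗ d) ** x)); last by rewrite x0 linear0.
  elim/tensor_ind: x {x0} => [a b|x y ex ey].
    by rewrite tmulE tmapE !sliceE scalegAr.
  by rewrite mulgDr !linearD /= mulgDr ex ey.
rewrite -[x]swapK; suff -> : swap x = 0 by rewrite linear0.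
apply: slice_eq0 => f; apply: nondegr => c.
transitivity (slice f (swap (tmap (lmulg c) idfun x))).
  elim/tensor_ind: x {x0 xc0} => [a b|x y ex ey].
    by rewrite tmapE !swapE !sliceE scalegAr.
  by rewrite !linearD /= mulgDr ex ey.
by rewrite xc0 !linear0.
Qed.

HB.instance Definition _ := NonUnitalAlgebra_isNonDegenerate.Build K
  (tensor A B) tensor_nondegl tensor_nondegr.
End TensorNonDegenerate.

(* lmult x a stands for x a and rmult x a for a x. *)
Record multiplier (K : fieldType) (A : ndAlgType K) := Multiplier {
  rmult : A -> A;
  lmult : A -> A;
  multiplierP : forall a b : A, rmult a ** b = a ** lmult b
}.

Section MultiplierAlgebra.
Variables (K : fieldType) (A : ndAlgType K).
Local Notation M := (multiplier A).
Implicit Types x y z : M.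

Lemma multiplier_eq x y :
  rmult x =1 rmult y -> lmult x =1 lmult y -> x = y.
Proof.
case: x y => [r l p] [r' l' p'] /= /funext er /funext el.
by move: p p'; rewrite er el => p p'; congr Multiplier; apply: Prop_irrelevance.
Qed.

Fact lmult_linear x : linear (lmult x).
Proof.
move=> k a b; apply/eqP; rewrite -subr_eq0; apply/eqP/nondegr => c.
by rewrite linearBr linearPr /= -!multiplierP linearPr subrr.
Qed.
HB.instance Definition _ x :=
  GRing.isLinear.Build K A A _ (lmult x) (lmult_linear x).

Fact rmult_linear x : linear (rmult x).
Proof.
move=> k a b; apply/eqP; rewrite -subr_eq0; apply/eqP/nondegl => c.
by rewrite linearBl linearPl /= !multiplierP linearPl subrr.
Qed.
HB.instance Definition _ x :=
  GRing.isLinear.Build K A A _ (rmult x) (rmult_linear x).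

HB.instance Definition _ := gen_eqMixin M.
HB.instance Definition _ := gen_choiceMixin M.

Fact zero_mult_subproof (a b : A) : (0 : A) ** b = a ** 0.
Proof. by rewrite linear0l linear0r. Qed.
Definition zero_mult : M := Multiplier zero_mult_subproof.

Fact add_mult_subproof x y (a b : A) :
  (rmult x a + rmult y a) ** b = a ** (lmult x b + lmult y b).
Proof. by rewrite mulgDl mulgDr !multiplierP. Qed.
Definition add_mult x y : M := Multiplier (add_mult_subproof x y).

Fact scale_mult_subproof k x (a b : A) :
  (k *: rmult x a) ** b = a ** (k *: lmult x b).
Proof. by rewrite scalegAl scalegAr multiplierP. Qed.
Definition scale_mult k x : M := Multiplier (scale_mult_subproof k x).

Fact opp_mult_subproof x (a b : A) : (- rmult x a) ** b = a ** (- lmult x b).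
Proof. by rewrite linearNl linearNr /= multiplierP. Qed.
Definition opp_mult x : M := Multiplier (opp_mult_subproof x).

Fact add_multA : associative add_mult.
Proof. by move=> x y z; apply: multiplier_eq => a /=; rewrite addrA. Qed.
Fact add_multC : commutative add_mult.
Proof. by move=> x y; apply: multiplier_eq => a /=; rewrite addrC. Qed.
Fact add_0mult : left_id zero_mult add_mult.
Proof. by move=> x; apply: multiplier_eq => a /=; rewrite add0r. Qed.
Fact add_Nmult : left_inverse zero_mult opp_mult add_mult.
Proof. by move=> x; apply: multiplier_eq => a /=; rewrite addNr. Qed.
HB.instance Definition _ :=
  GRing.isZmodule.Build M add_multA add_multC add_0mult add_Nmult.

Fact scale_multA a b x : scale_mult a (scale_mult b x) = scale_mult (a * b) x.
Proof. by apply: multiplier_eq => c /=; rewrite scalerA. Qed.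
Fact scale_mult1 : left_id 1 scale_mult.
Proof. by move=> x; apply: multiplier_eq => a /=; rewrite scale1r. Qed.
Fact scale_multDr : right_distributive scale_mult +%R.
Proof. by move=> k x y; apply: multiplier_eq => a /=; rewrite scalerDr. Qed.
Fact scale_multDl x : {morph scale_mult^~ x : k l / k + l}.
Proof. by move=> k l; apply: multiplier_eq => a /=; rewrite scalerDl. Qed.
HB.instance Definition _ := GRing.Zmodule_isLmodule.Build K M
  scale_multA scale_mult1 scale_multDr scale_multDl.

Fact one_mult_subproof (a b : A) : idfun a ** b = a ** idfun b.
Proof. by []. Qed.
Definition one_mult : M := Multiplier one_mult_subproof.

Fact mul_mult_subproof x y (a b : A) :
  rmult y (rmult x a) ** b = a ** lmult x (lmult y b).
Proof. by rewrite !multiplierP. Qed.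
Definition mul_mult x y : M := Multiplier (mul_mult_subproof x y).

Fact mul_multA : associative mul_mult.
Proof. by move=> x y z; apply: multiplier_eq. Qed.
Fact mul_1mult : left_id one_mult mul_mult.
Proof. by move=> x; apply: multiplier_eq. Qed.
Fact mul_mult1 : right_id one_mult mul_mult.
Proof. by move=> x; apply: multiplier_eq. Qed.
Fact mul_multDl : left_distributive mul_mult +%R.
Proof. by move=> x y z; apply: multiplier_eq => a //=; rewrite linearD. Qed.
Fact mul_multDr : right_distributive mul_mult +%R.
Proof. by move=> x y z; apply: multiplier_eq => a //=; rewrite linearD. Qed.
(* M(A) = 0 when A = 0, hence a possibly zero ring. *)
HB.instance Definition _ := GRing.Zmodule_isPzRing.Build M
  mul_multA mul_1mult mul_mult1 mul_multDl mul_multDr.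

Lemma scale_multAl k x y : k *: (x * y) = (k *: x) * y.
Proof. by apply: multiplier_eq => a //=; rewrite linearZ. Qed.
Lemma scale_multAr k x y : k *: (x * y) = x * (k *: y).
Proof. by apply: multiplier_eq => a //=; rewrite linearZ. Qed.

Fact inM_subproof (c a b : A) : rmulg c a ** b = a ** lmulg c b.
Proof. by rewrite /rmulg /lmulg mulgA. Qed.
Definition inM (c : A) : M := Multiplier (inM_subproof c).

Fact inM_linear : linear inM.
Proof.
move=> k a b; apply: multiplier_eq => c /=.
  by rewrite /rmulg linearPr.
by rewrite /lmulg linearPl.
Qed.
HB.instance Definition _ := GRing.isLinear.Build K A M _ inM inM_linear.

Lemma inMM a b : inM (a ** b) = inM a * inM b.
Proof.
by apply: multiplier_eq => c /=; rewrite /rmulg /lmulg ?mulgA.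
Qed.

Lemma inM_inj : injective inM.
Proof.
move=> a b ab; apply/eqP; rewrite -subr_eq0; apply/eqP/nondegl => c.
by rewrite linearBl /= -[X in X - _]/(lmult (inM a) c) ab subrr.
Qed.

Definition from_alg x : Prop := exists a, x = inM a.

(* The a in A such that x = inM a if there is one, and 0 otherwise. *)
Definition outM x : A := xget 0 [set a | inM a = x]%classic.

Lemma outMK x : from_alg x -> inM (outM x) = x.
Proof. by case=> a xa; rewrite /outM; case: xgetP => // /(_ a); rewrite /= xa. Qed.

Lemma inMK : cancel inM outM.
Proof. by move=> a; apply: inM_inj; apply: outMK; exists a. Qed.

End MultiplierAlgebra.

Section TensorMultiplier.
Variables (K : fieldType) (A B : ndAlgType K).

Fact mtens_subproof (x : multiplier A) (y : multiplier B) (s t : tensor A B) :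
  tmap (rmult x) (rmult y) s ** t = s ** tmap (lmult x) (lmult y) t.
Proof.
elim/tensor_ind: s => [a b|s s' es es']; last by rewrite linearD /= !mulgDl es es'.
elim/tensor_ind: t => [a' b'|t t' et et']; last by rewrite linearD /= !mulgDr et et'.
by rewrite !tmapE !tmulE !multiplierP.
Qed.

(* The image of x ⊗ y under M(A) ⊗ M(B) -> M(A ⊗ B). *)
Definition mtens (x : multiplier A) (y : multiplier B) :
  multiplier (tensor A B) := Multiplier (mtens_subproof x y).

Fact mtens_bilinear : bilinear_for *:%R *:%R mtens.
Proof.
split=> [y k x x'|x k y y']; apply: multiplier_eq; elim/tensor_ind => [a b|s t es et];
  rewrite /= ?tmapE /= ?(linearPl, linearPr) //.
all: by rewrite !linearD /= addrACA; congr (_ + _).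
Qed.
HB.instance Definition _ := bilinear_isBilinear.Build K
  (multiplier A) (multiplier B) (multiplier (tensor A B)) _ _
  mtens mtens_bilinear.
End TensorMultiplier.

Section Associator.
Variables (K : fieldType) (U V W : lmodType K).

Definition assocl_fun2 (u : U) (v : V) (w : W) : tensor (tensor U V) W :=
  (u ⊗ v) ⊗ w.
Fact assocl_fun2_bilinear u : bilinear_for *:%R *:%R (assocl_fun2 u).
Proof.
by split=> [w k x y|v k x y]; rewrite /assocl_fun2 ?linearPr // linearPl.
Qed.
HB.instance Definition _ u := bilinear_isBilinear.Build K V W
  (tensor (tensor U V) W) _ _ (assocl_fun2 u) (assocl_fun2_bilinear u).

Definition assocl_fun (u : U) (x : tensor V W) := tlift (assocl_fun2 u) x.
Fact assocl_fun_bilinear : bilinear_for *:%R *:%R assocl_fun.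
Proof.
split=> [x k u u'|u k x y]; last exact: linearP.
elim/tensor_ind: x => [v w|x y ex ey] /=.
  by rewrite /assocl_fun !tliftE /= /assocl_fun2 !linearPl.
by rewrite /assocl_fun !linearD /= addrACA; congr (_ + _).
Qed.
HB.instance Definition _ := bilinear_isBilinear.Build K U (tensor V W)
  (tensor (tensor U V) W) _ _ assocl_fun assocl_fun_bilinear.

Definition assocl : tensor U (tensor V W) -> tensor (tensor U V) W :=
  tlift assocl_fun.
HB.instance Definition _ := GRing.Linear.on assocl.

Lemma assoclE u v w : assocl (u ⊗ (v ⊗ w)) = (u ⊗ v) ⊗ w.
Proof. by rewrite /assocl tliftE /= /assocl_fun tliftE. Qed.

Definition assocr_fun2 (w : W) (u : U) (v : V) : tensor U (tensor V W) :=
  u ⊗ (v ⊗ w).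
Fact assocr_fun2_bilinear w : bilinear_for *:%R *:%R (assocr_fun2 w).
Proof.
by split=> [v k x y|u k x y]; rewrite /assocr_fun2 ?linearPl // linearPr.
Qed.
HB.instance Definition _ w := bilinear_isBilinear.Build K U V
  (tensor U (tensor V W)) _ _ (assocr_fun2 w) (assocr_fun2_bilinear w).

Definition assocr_fun (x : tensor U V) (w : W) := tlift (assocr_fun2 w) x.
Fact assocr_fun_bilinear : bilinear_for *:%R *:%R assocr_fun.
Proof.
split=> [w k x y|x k w w']; first exact: linearP.
elim/tensor_ind: x => [u v|x y ex ey] /=.
  by rewrite /assocr_fun !tliftE /= /assocr_fun2 !linearPr.
by rewrite /assocr_fun !linearD /= addrACA; congr (_ + _).
Qed.
HB.instance Definition _ := bilinear_isBilinear.Build K (tensor U V) W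
  (tensor U (tensor V W)) _ _ assocr_fun assocr_fun_bilinear.

Definition assocr : tensor (tensor U V) W -> tensor U (tensor V W) :=
  tlift assocr_fun.
HB.instance Definition _ := GRing.Linear.on assocr.

Lemma assocrE u v w : assocr ((u ⊗ v) ⊗ w) = u ⊗ (v ⊗ w).
Proof. by rewrite /assocr tliftE /= /assocr_fun tliftE. Qed.

Lemma tensor_ind3 (P : tensor (tensor U V) W -> Prop) :
    (forall u v w, P ((u ⊗ v) ⊗ w)) ->
    (forall x y, P x -> P y -> P (x + y)) ->
  forall x, P x.
Proof.
move=> Pt PD; apply: tensor_ind => // x w.
by elim/tensor_ind: x => // x y Px Py; rewrite linearDl; apply: PD.
Qed.

Lemma assocrK : cancel assocr assocl.
Proof.
apply: tensor_ind3 => [u v w|x y ex ey]; first by rewrite assocrE assoclE.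
by rewrite !linearD /= ex ey.
Qed.

Lemma assoclK : cancel assocl assocr.
Proof.
apply: tensor_ind => [u x|x y ex ey]; last by rewrite !linearD /= ex ey.
elim/tensor_ind: x => [v w|x y ex ey]; first by rewrite assoclE assocrE.
by rewrite linearDr !linearD /= ex ey.
Qed.
End Associator.

Section AssociatorMultiplier.
Variables (K : fieldType) (A B C : ndAlgType K).

Lemma assocrM (x y : tensor (tensor A B) C) :
  assocr (x ** y) = assocr x ** assocr y.
Proof.
elim/tensor_ind3: x => [a b c|x x' ex ex']; last first.
  by rewrite mulgDl !linearD /= mulgDl ex ex'.
elim/tensor_ind3: y => [a' b' c'|y y' ey ey'].
  by rewrite !(assocrE, tmulE).
by rewrite mulgDr !linearD /= mulgDr ey ey'.
Qed.

Fact massoc_subproof (x : multiplier (tensor A (tensor B C)))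
    (s t : tensor (tensor A B) C) :
  assocl (rmult x (assocr s)) ** t = s ** assocl (lmult x (assocr t)).
Proof.
apply: (can_inj (@assocrK K A B C)).
by rewrite !assocrM !assoclK multiplierP.
Qed.

(* M(A ⊗ (B ⊗ C)) is identified with M((A ⊗ B) ⊗ C) along the associator. *)
Definition massoc (x : multiplier (tensor A (tensor B C))) :
  multiplier (tensor (tensor A B) C) := Multiplier (massoc_subproof x).
End AssociatorMultiplier.

Section MultiplierHopfAlgebra.
Variables (K : fieldType) (A : ndAlgType K).
Local Notation AA := (tensor A A).
Local Notation M2 := (multiplier AA).
Local Notation M3 := (multiplier (tensor AA A)).
Variable Delta : {linear A -> M2}.

(* Delta(a)(1 ⊗ b) *)
Definition right_galois_fun (a b : A) : M2 := Delta a * mtens 1 (inM b).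
(* (a ⊗ 1)Delta(b) *)
Definition left_galois_fun (a b : A) : M2 := mtens (inM a) 1 * Delta b.

Fact right_galois_fun_bilinear : bilinear_for *:%R *:%R right_galois_fun.
Proof.
split=> [b k a a'|a k b b']; rewrite /right_galois_fun /=.
  by rewrite linearP mulrDl -scale_multAl.
by rewrite linearP linearPr /= mulrDr -scale_multAr.
Qed.
Fact left_galois_fun_bilinear : bilinear_for *:%R *:%R left_galois_fun.
Proof.
split=> [b k a a'|a k b b']; rewrite /left_galois_fun /=.
  by rewrite linearP linearPl /= mulrDl -scale_multAl.
by rewrite linearP mulrDr -scale_multAr.
Qed.
HB.instance Definition _ := bilinear_isBilinear.Build K A A M2 _ _
  right_galois_fun right_galois_fun_bilinear.
HB.instance Definition _ := bilinear_isBilinear.Build K A A M2 _ _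
  left_galois_fun left_galois_fun_bilinear.

(* The linear maps a ⊗ b |-> Delta(a)(1 ⊗ b) and a ⊗ b |-> (a ⊗ 1)Delta(b) from
   A ⊗ A to A ⊗ A; outM is only meaningful once their values as multipliers
   are known to belong to A ⊗ A. *)
Definition right_galois (t : AA) : AA := outM (tlift right_galois_fun t).
Definition left_galois (t : AA) : AA := outM (tlift left_galois_fun t).

Lemma right_galoisE a b : right_galois (a ⊗ b) = outM (right_galois_fun a b).
Proof. by rewrite /right_galois tliftE. Qed.
Lemma left_galoisE a b : left_galois (a ⊗ b) = outM (left_galois_fun a b).
Proof. by rewrite /left_galois tliftE. Qed.

Definition Delta_id_fun (a b : A) : M3 := mtens (Delta a) (inM b).
Definition id_Delta_fun (a b : A) : M3 := massoc (mtens (inM a) (Delta b)).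

Fact Delta_id_fun_bilinear : bilinear_for *:%R *:%R Delta_id_fun.
Proof.
by split=> [b k a a'|a k b b']; rewrite /Delta_id_fun linearP ?linearPl ?linearPr.
Qed.
Fact massoc_linear : linear (@massoc K A A A).
Proof. by move=> k x y; apply: multiplier_eq => a /=; rewrite linearP. Qed.
Fact id_Delta_fun_bilinear : bilinear_for *:%R *:%R id_Delta_fun.
Proof.
by split=> [b k a a'|a k b b'];
  rewrite /id_Delta_fun linearP ?linearPl ?linearPr -massoc_linear.
Qed.
HB.instance Definition _ := bilinear_isBilinear.Build K A A M3 _ _
  Delta_id_fun Delta_id_fun_bilinear.
HB.instance Definition _ := bilinear_isBilinear.Build K A A M3 _ _
  id_Delta_fun id_Delta_fun_bilinear.

(* Delta ⊗ iota and iota ⊗ Delta, as maps A ⊗ A -> M(A ⊗ A ⊗ A) *)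
Definition Delta_id : AA -> M3 := tlift Delta_id_fun.
Definition id_Delta : AA -> M3 := tlift id_Delta_fun.

Record is_multiplier_hopf_algebra : Prop := {
  comulM : forall a b, Delta (a ** b) = Delta a * Delta b;
  comul_right : forall a b, from_alg (Delta a * mtens 1 (inM b));
  comul_left : forall a b, from_alg (mtens (inM a) 1 * Delta b);
  comul_coassoc : forall a b c,
    mtens (mtens (inM a) 1) 1 * Delta_id (outM (Delta b * mtens 1 (inM c))) =
    id_Delta (outM (mtens (inM a) 1 * Delta b)) * mtens (mtens 1 1) (inM c);
  right_galois_bij : bijective right_galois;
  left_galois_bij : bijective left_galois
}.
End MultiplierHopfAlgebra.

(* Main.v *)
Require Import Defs.
From mathcomp Require Import all_boot all_order all_algebra.
From mathcomp Require Import boolp.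

Set Implicit Arguments.
Unset Strict Implicit.
Unset Printing Implicit Defensive.

Import GRing.Theory.
Local Open Scope ring_scope.

(* Write T1 (a ⊗ b) = Delta(a)(1 ⊗ b) and T2 (a ⊗ b) = (a ⊗ 1)Delta(b). Fix b.
   As (c ⊗ 1)T1 (b ⊗ a_i) = T2 (c ⊗ b)(1 ⊗ a_i) for all c, linear algebra and
   non-degeneracy give a single Y in A ⊗ A with T1 (b ⊗ a_i) = Y (1 ⊗ a_i) for
   all i. The inverse of T1 commutes with right multiplication on the second
   leg, so for a functional f with f(b) = 1 the element
   e = (f ⊗ iota)(T1^-1 (Y)) satisfies
   e a_i = (f ⊗ iota)(T1^-1 (T1 (b ⊗ a_i))) = a_i.
   Symmetrically there is e' with a_i e' = a_i, and e + e' - e' e is a two-sided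
   unit for the a_i. *)

Section TensorLinear.
Context {K : fieldType}.

Lemma separated_eq0 (V : lmodType K) (v : V) :
  (forall f : {linear V -> K^o}, f v = 0) -> v = 0.
Proof.
move=> v0; apply/eqP/negPn/negP => /separating_functional[f fv].
by have /eqP := fv; rewrite v0 eq_sym oner_eq0.
Qed.

Lemma swap_tmap (U U' V V' : lmodType K)
    (f : {linear U -> U'}) (g : {linear V -> V'}) (t : tensor U V) :
  swap (tmap f g t) = tmap g f (swap t).
Proof.
elim/tensor_ind: t => [u v|x y ex ey]; first by rewrite swapE !tmapE swapE.
by rewrite !linearD /= ex ey.
Qed.

Lemma slice_tmapr (U V W : lmodType K) (f : {linear U -> K^o})
    (g : {linear V -> W}) (t : tensor U V) :
  slice f (tmap idfun g t) = g (slice f t).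
Proof.
elim/tensor_ind: t => [u v|x y ex ey]; first by rewrite tmapE !sliceE linearZ.
by rewrite !linearD /= ex ey.
Qed.

(** Concatenate expansions of the [Z i], padding each term with second leg 0 at the other indices.
    Shared first legs allow one induction to treat all [Z i] at once. *)
Lemma tensor_family_seq (U W : lmodType K) (I : finType) (Z : I -> tensor U W) :
  exists s : seq (U * (I -> W)), forall i, Z i = \sum_(q <- s) q.1 ⊗ q.2 i.
Proof.
have [s sP] := choice (fun i => tensor_seq (Z i)).
exists (flatten [seq [seq (p.1, fun j => if i == j then p.2 else 0) | p <- s i]
                | i <- enum I]) => j.
rewrite big_flatten big_map big_enum /= (bigD1 j) //= big_map /=.
rewrite [X in _ + X]big1 ?addr0 => [|i ij]; last first.
  by rewrite big_map big1 // => p _ /=; rewrite (negPf ij) linear0r.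
by rewrite sP; apply: eq_bigr => p _; rewrite eqxx.
Qed.

(* If the maps m c are jointly injective and the W-legs of all (m c ⊗ id)(Z i)
   factor uniformly in i through phi i, then so do those of Z i. *)
Lemma tensor_descent (U V W : lmodType K) (C : Type)
    (m : C -> {linear U -> U}) (I : finType) (phi : I -> {linear V -> W})
    (Z : I -> tensor U W) :
    (forall u, (forall c, m c u = 0) -> u = 0) ->
    (forall c, exists Y, forall i,
       tmap (m c) idfun (Z i) = tmap idfun (phi i) Y) ->
  exists Y, forall i, Z i = tmap idfun (phi i) Y.
Proof.
move=> m_inj; have [s sP] := tensor_family_seq Z.
elim: (size s) {-2}s Z sP (erefl (size s)) => {s} [|n IHn] [|[p w] s] // Z sP.
  by exists 0 => i; rewrite sP big_nil linear0.
case=> sn mZ.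
(* If the head leg [w] is, uniformly in [i], some [phi i v] plus a combination of the other legs,
   subtracting [p ⊗ phi i v] lets the remaining terms absorb the head. Otherwise [p] must vanish. *)
have [[v [k wE]]|nrel] := pselect (exists (v : V) (k : U * (I -> W) -> K),
    forall i, w i = phi i v + \sum_(q <- s) k q *: q.2 i).
  have ZE i : Z i - p ⊗ phi i v =
      \sum_(q <- [seq (q.1 + k q *: p, q.2) | q <- s]) q.1 ⊗ q.2 i.
    rewrite sP big_cons big_map /= wE linearDr /= addrC -!addrA addKr.
    rewrite addrC linear_sumr -big_split /=.
    by apply: eq_bigr => q _; rewrite linearDl linearZl_LR linearZr_LR.
  have [||Y YP] := IHn _ _ ZE.
  - by rewrite size_map.
  - move=> c; have [Y YP] := mZ c; exists (Y - m c p ⊗ v) => i.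
    by rewrite !linearB /= YP !tmapE.
  by exists (Y + p ⊗ v) => i; rewrite linearD /= -YP tmapE subrK.
have p0 : p = 0.
  apply: m_inj => c; apply: separated_eq0 => h; apply: contrapT => /eqP hp.
  have [Y YP] := mZ c; apply: nrel.
  (* Slicing the factorization at [c] by [h] gives a linear equation in which [w i] has the
     invertible coefficient [h (m c p)]; solving for [w i] gives the excluded relation. *)
  exists ((h (m c p))^-1 *: slice h Y).
  exists (fun q => - ((h (m c p))^-1 * h (m c q.1))) => i.
  have := congr1 (slice h) (YP i); rewrite slice_tmapr sP big_cons !linearD /=.
  rewrite tmapE sliceE !linear_sum /= => /(canRL (addrK _)) /(canRL (scalerK hp)) ->.
  rewrite linearZ scalerBr; congr (_ + _); rewrite scaler_sumr -sumrN.
  by apply: eq_bigr => q _ /=; rewrite tmapE sliceE scaleNr scalerA.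
by apply: (IHn s Z) => // i; rewrite sP big_cons /= p0 linear0l add0r.
Qed.
End TensorLinear.

Section Galois.
Context {K : fieldType} {A : ndAlgType K}.
Variable Delta : {linear A -> multiplier (tensor A A)}.
Hypothesis HA : is_multiplier_hopf_algebra Delta.
Local Notation T1 := (right_galois Delta).
Local Notation T2 := (left_galois Delta).

Lemma from_algD (B : ndAlgType K) (x y : multiplier B) :
  from_alg x -> from_alg y -> from_alg (x + y).
Proof. by move=> [a ->] [b ->]; exists (a + b); rewrite linearD. Qed.

(** Condition (1) ensures that [outM] never takes its default value here, so identities for [T1] can
    be checked among multipliers. *)
Lemma inM_right_galois t : inM (T1 t) = tlift (right_galois_fun Delta) t.
Proof.
apply: outMK; elim/tensor_ind: t => [a b|x y ex ey].
  by rewrite tliftE; apply: comul_right.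
by rewrite linearD; apply: from_algD.
Qed.

Lemma inM_left_galois t : inM (T2 t) = tlift (left_galois_fun Delta) t.
Proof.
apply: outMK; elim/tensor_ind: t => [a b|x y ex ey].
  by rewrite tliftE; apply: comul_left.
by rewrite linearD; apply: from_algD.
Qed.

(** Turns an operation on one leg into a product of multipliers, so that associativity in M(A ⊗ A)
    applies. *)
Lemma inM_rmulr (c : A) (t : tensor A A) :
  inM (tmap idfun (rmulg c) t) = inM t * mtens 1 (inM c).
Proof.
elim/tensor_ind: t => [a b|x y ex ey]; last by rewrite !linearD /= ex ey mulrDl.
rewrite tmapE; apply: multiplier_eq; elim/tensor_ind => [a' b'|x y ex ey].
- by rewrite /= /rmulg !tmulE tmapE /= /rmulg mulgA.
- by move: ex ey; rewrite !linearD /= => -> ->.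
- by rewrite /= /lmulg !tmulE tmapE /= tmulE /rmulg /lmulg mulgA.
- by move: ex ey; rewrite !linearD /= => -> ->.
Qed.

Lemma inM_lmull (c : A) (t : tensor A A) :
  inM (tmap (lmulg c) idfun t) = mtens (inM c) 1 * inM t.
Proof.
elim/tensor_ind: t => [a b|x y ex ey]; last by rewrite !linearD /= ex ey mulrDr.
rewrite tmapE; apply: multiplier_eq; elim/tensor_ind => [a' b'|x y ex ey].
- by rewrite /= /rmulg !tmulE tmapE /= tmulE /lmulg /rmulg mulgA.
- by move: ex ey; rewrite !linearD /= => -> ->.
- by rewrite /= /lmulg !tmulE tmapE /= /lmulg mulgA.
- by move: ex ey; rewrite !linearD /= => -> ->.
Qed.

(** Reduces to (1 ⊗ b)(1 ⊗ c) = 1 ⊗ bc. The inverse of [T1] inherits this equivariance. *)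
Lemma right_galois_rmulr c t :
  T1 (tmap idfun (rmulg c) t) = tmap idfun (rmulg c) (T1 t).
Proof.
apply: inM_inj; rewrite inM_rmulr !inM_right_galois.
elim/tensor_ind: t => [a b|x y ex ey]; last by rewrite !linearD /= mulrDl ex ey.
rewrite tmapE !tliftE /= /right_galois_fun -mulrA; congr (_ * _).
apply: multiplier_eq; elim/tensor_ind => [a' b'|x y ex ey].
all: rewrite /= ?tmapE //= /lmulg /rmulg ?mulgA //.
all: by move: ex ey; rewrite !linearD /= => -> ->.
Qed.

Lemma left_galois_lmull c t :
  T2 (tmap (lmulg c) idfun t) = tmap (lmulg c) idfun (T2 t).
Proof.
apply: inM_inj; rewrite inM_lmull !inM_left_galois.
elim/tensor_ind: t => [a b|x y ex ey]; last by rewrite !linearD /= mulrDr ex ey.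
rewrite tmapE !tliftE /= /left_galois_fun mulrA; congr (_ * _).
apply: multiplier_eq; elim/tensor_ind => [a' b'|x y ex ey].
all: rewrite /= ?tmapE //= /lmulg /rmulg ?mulgA //.
all: by move: ex ey; rewrite !linearD /= => -> ->.
Qed.

(** Both sides are (c ⊗ 1)Delta(b)(1 ⊗ a). *)
Lemma galois_exchange a b c :
  tmap (lmulg c) idfun (T1 (b ⊗ a)) = tmap idfun (rmulg a) (T2 (c ⊗ b)).
Proof.
apply: inM_inj; rewrite inM_lmull inM_rmulr inM_right_galois inM_left_galois.
by rewrite !tliftE /= mulrA.
Qed.

Lemma left_local_unit n (a : 'I_n -> A) : exists e, forall i, e ** a i = a i.
Proof.
(* A functional with [f b = 1] requires a nonzero [b]: some nonzero [a i0] serves, and if there is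
   none, 0 is a unit. *)
have [a0|/asboolP] := pselect (forall i, a i = 0).
  by exists 0 => i; rewrite a0 linear0r.
rewrite asbool_neg => /existsp_asboolPn[i0 /eqP/separating_functional[f fb]].
set b := a i0 in fb.
have [G GK KG] := right_galois_bij HA.
have [c|c|Y YP] := @tensor_descent _ A A A A (@lmulg K A) _
  (fun i => rmulg (a i)) (fun i => T1 (b ⊗ a i)).
- by move=> c0; apply: nondegr.
- by exists (T2 (c ⊗ b)) => i; apply: galois_exchange.
exists (slice f (G Y)) => i.
rewrite -[LHS]/(rmulg (a i) _) -slice_tmapr.
rewrite -[tmap _ _ _]GK right_galois_rmulr KG -YP GK.
by rewrite sliceE fb scale1r.
Qed.

(** Mirror argument with [T2]. Here [b] sits in the second leg, while [tensor_descent] and [slice]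
    treat the first, hence the swaps. *)
Lemma right_local_unit n (a : 'I_n -> A) : exists e, forall i, a i ** e = a i.
Proof.
have [a0|/asboolP] := pselect (forall i, a i = 0).
  by exists 0 => i; rewrite a0 linear0l.
rewrite asbool_neg => /existsp_asboolPn[i0 /eqP/separating_functional[f fb]].
set b := a i0 in fb.
have [G GK KG] := left_galois_bij HA.
have [c|c|Y YP] := @tensor_descent _ A A A A (@rmulg K A) _
  (fun i => lmulg (a i)) (fun i => swap (T2 (a i ⊗ b))).
- by move=> c0; apply: nondegl.
- exists (swap (T1 (b ⊗ c))) => i.
  by rewrite -!swap_tmap galois_exchange.
exists (slice f (swap (G (swap Y)))) => i.
rewrite -[LHS]/(lmulg (a i) _) -slice_tmapr -swap_tmap.
rewrite -[tmap _ _ _]GK left_galois_lmull KG -swap_tmap -YP swapK GK.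
by rewrite swapE sliceE fb scale1r.
Qed.
End Galois.

Theorem proposition3p3 (K : fieldType) (A : ndAlgType K)
    (Delta : {linear A -> multiplier (tensor A A)})
    (HA : is_multiplier_hopf_algebra Delta) (n : nat) (a : 'I_n -> A) :
  exists e : A, forall i : 'I_n, a i ** e = a i /\ e ** a i = a i.
Proof.
have [e eP] := left_local_unit HA a.
have [e' e'P] := right_local_unit HA a.
(* This is 1 - (1 - e')(1 - e), where 1 - e' is killed by [a i] on its left and 1 - e by [a i] on
   its right. *)
exists (e + e' - e' ** e) => i; split.
  by rewrite linearBr /= mulgDr e'P mulgA e'P addrAC subrr add0r.
by rewrite linearBl /= mulgDl -mulgA eP addrK.
Qed.
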